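(* Let $p_1,\dots,p_n$ be distinct primes and $N=p_1^{\alpha_1}\cdots p_n^{\alpha_n}$ with $\alpha_1\ge \alpha_2\ge\cdots\ge \alpha_u>\alpha_{u+1}=\cdots =\alpha_n\ge 2$ (where $u=0$ if all $\alpha_i$ are equal). Then $R(\{p_{u+1}\},N),\ldots,R(\{p_n\},N)$ are all the maximal $N$-sets with the minimum size; that is, a set of positive divisors of $N$ is a maximal $N$-set with the minimum size if and only if it equals $R(\{p_v\},N)=\{d: d\mid N,\ p_v\mid d\}$ for some $u+1\le v\le n$.
   Context: A set $\mathcal D$ of positive divisors of $N$ is an $N$-set if no two elements of $\mathcal D$ are coprime; an $N$-set is maximal if no additional positive divisor of $N$ can be included in it while keeping the $N$-set property. ''Maximal $N$-set with the minimum size'' means a maximal $N$-set whose cardinality is the minimum of the cardinalities of all maximal $N$-sets. For a set $\mathcal T$ of positive divisors of $N$, $R(\mathcal T,N)$ denotes the set of all positive divisors of $N$ that are divisible by at least one element of $\mathcal T$. *)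

(* Defs.v *)
From mathcomp Require Import all_boot.
From mathcomp Require Export finmap.

Set Implicit Arguments.
Unset Strict Implicit.
Unset Printing Implicit Defensive.

Local Open Scope fset_scope.

(* d = e is allowed: since 1 is coprime to itself, 1 belongs to no N-set.
   Otherwise {1} would be a maximal N-set for every N. *)
Definition Nset (N : nat) (D : {fset nat}) : Prop :=
  {subset D <= divisors N} /\
  (forall d e : nat, d \in D -> e \in D -> ~~ coprime d e).

Definition maximal_Nset (N : nat) (D : {fset nat}) : Prop :=
  Nset N D /\
  (forall d : nat, d \in divisors N -> d \notin D -> ~ Nset N (d |` D)).

Definition min_maximal_Nset (N : nat) (D : {fset nat}) : Prop :=
  maximal_Nset N D /\
  (forall E : {fset nat}, maximal_Nset N E -> #|` D| <= #|` E|).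

Definition R (T : {fset nat}) (N : nat) : {fset nat} :=
  [fset d in divisors N | has (fun t => t %| d) T].

Lemma in_R (T : {fset nat}) (N d : nat) :
  (d \in R T N) = (d \in divisors N) && has (fun t => t %| d) T.
Proof. by rewrite !inE. Qed.

(* Main.v *)
(** Identify the divisors of N with their exponent vectors, and let C be the set of
    divisors outside a maximal N-set. Any two vectors in C vanish at a common
    coordinate: each is coprime to some member of the N-set, and these two members
    share a prime. Put m = alpha_n + 1. The m shifts of a vector by (c, ..., c),
    c < m, taken modulo alpha_i + 1, disagree pairwise in every coordinate, so at most
    one lies in C; hence m |C| is at most the number of divisors, with equality iff
    every vector has a shift in C. Since m >= 3, equality forces C to contain all
    vectors vanishing at some fixed v with alpha_v + 1 = m, i.e. the N-set is
    R({p_v}, N). *)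

Require Import Defs.
From mathcomp Require Import all_boot finmap zify.

(** * Shifts of exponent vectors and families with common zeros *)

Section ExponentVectors.

Variables (n : nat) (alpha : 'I_n -> nat).

Definition expvec := {dffun forall i : 'I_n, 'I_(alpha i).+1}.

(* Addition of c modulo alpha i + 1, meaningful only for c <= alpha i + 1. *)
Definition shift (c : nat) (x : expvec) : expvec :=
  [ffun i => inord (if x i + c <= alpha i then x i + c else x i + c - (alpha i).+1)].

Lemma shiftE (c : nat) (x : expvec) (i : 'I_n) : c <= (alpha i).+1 ->
  shift c x i = (if x i + c <= alpha i then x i + c else x i + c - (alpha i).+1) :> nat.
Proof.
move=> hc; have xi := ltn_ord (x i); rewrite ffunE inordK //; case: ifP; lia.
Qed.

Lemma shift_inj (c : nat) :
  (forall i, c <= (alpha i).+1) -> injective (shift c).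
Proof.
move=> hc x y exy; apply/ffunP => i; apply/val_inj => /=.
have := congr1 (fun z : expvec => nat_of_ord (z i)) exy.
rewrite /= !shiftE //; have := ltn_ord (x i); have := ltn_ord (y i).
by case: ifP; case: ifP; lia.
Qed.

(** Double counting of the pairs (x, c): each shift is a permutation, so every c contributes
    [#|C|]. *)
Lemma sum_card_shift (C : pred expvec) (m : nat) :
  (forall i, m <= (alpha i).+1) ->
  \sum_x #|[set c : 'I_m | C (shift c x)]| = m * #|C|.
Proof.
move=> hm.
under eq_bigr => x _ do rewrite -sum1dep_card big_mkcond /=.
rewrite exchange_big /= (eq_bigr (fun=> #|C|)); last first.
  move=> c _; rewrite -big_mkcond sum1dep_card /=.
  have hc i : c <= (alpha i).+1 by have := ltn_ord c; have := hm i; lia.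
  rewrite -[RHS](on_card_preimset (f := shift c) (R := C)).
    by apply: eq_card => x; rewrite !inE.
  exact: onW_bij (injF_bij (@shift_inj c hc)).
by rewrite sum_nat_const card_ord.
Qed.

Definition share_zeros (C : pred expvec) : Prop :=
  forall x y, C x -> C y -> exists i, x i = 0 :> nat /\ y i = 0 :> nat.

Lemma leqif_card_share_zeros (C : pred expvec) (m : nat) :
  (forall i, m <= (alpha i).+1) -> share_zeros C ->
  m * #|C| <= #|expvec| ?= iff [forall x, [exists c : 'I_m, C (shift c x)]].
Proof.
move=> hm hC; rewrite -sum_card_shift // -sum1_card.
apply: leqif_sum => x _.
(* If the shifts by c and d both vanish at i, then c and d are congruent modulo [alpha i + 1 >= m],
   hence equal. *)
have le1 : #|[set c : 'I_m | C (shift c x)]| <= 1.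
  apply/card_le1_eqP => c d; rewrite !inE => Cc Cd; apply/val_inj => /=.
  have [i []] := hC _ _ Cc Cd.
  have := ltn_ord c; have := ltn_ord d; have := hm i; have := ltn_ord (x i).
  by move=> h1 h2 h3 h4; rewrite !shiftE; [case: ifP; case: ifP; lia|lia|lia].
split=> //; apply/idP/existsP => [/eqP h|[c Cc]].
  have /card_gt0P[c] : 0 < #|[set c : 'I_m | C (shift c x)]| by rewrite h.
  by rewrite inE; exists c.
by rewrite eqn_leq le1; apply/card_gt0P; exists c; rewrite inE.
Qed.

(** This is the equality case of [leqif_card_share_zeros]: with [m = alpha v + 1], some shift brings
    coordinate v of any vector to 0. *)
Lemma card_coord_zero (v : 'I_n) :
  (forall i, (alpha v) <= alpha i) ->
  (alpha v).+1 * #|[pred x : expvec | x v == 0 :> nat]| = #|expvec|.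
Proof.
move=> hv; apply/eqP; rewrite leqif_card_share_zeros.
- apply/forallP => x; apply/existsP.
  have hx := ltn_ord (x v).
  exists (inord (if x v == 0 :> nat then 0 else (alpha v).+1 - x v)) => /=.
  rewrite inordK; last by case: ifP; lia.
  rewrite shiftE; last by case: ifP; lia.
  move: (nat_of_ord (x v)) hx => k hx; case: (k =P 0) => k0; case: ifP; lia.
- by move=> i; exact: hv.
- by move=> x y /eqP hx /eqP hy; exists v.
Qed.

(* If every orbit meets C, a minimal zero set A of a vector in C is a singleton:
   some vector has zero set {v}, A \ {v} and ~A after shifting by 0, 1 and 2, and
   no zero after any other shift below m. *)
Lemma share_zeros_star (C : pred expvec) (m : nat) :
  2 < m -> (forall i, m <= (alpha i).+1) -> share_zeros C ->
  (forall x y : expvec,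
     C x -> (forall i, x i = 0 :> nat -> y i = 0 :> nat) -> C y) ->
  (forall x, exists c : 'I_m, C (shift c x)) ->
  exists v, alpha v < m /\ forall y : expvec, y v = 0 :> nat -> C y.
Proof.
move=> m_gt2 hm hC Cup orb.
(* The 0/1 vector with zero set A; as C is closed under enlarging zero sets, these vectors represent
   all of C. *)
pose vec (A : {set 'I_n}) : expvec := [ffun i => inord (i \notin A)].
have vecE (A : {set 'I_n}) i : vec A i = (i \notin A) :> nat.
  by rewrite ffunE inordK //; have := hm i; case: (_ \notin _); lia.
have Cvec (x : expvec) (A : {set 'I_n}) : C x -> (forall i, x i = 0 :> nat -> i \in A) -> C (vec A).
  by move=> Cx h; apply: (Cup x) => // i /h; rewrite vecE => ->.
have [A0 CA0] : exists A, C (vec A).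
  have [c Cc] := orb (vec set0); exists setT.
  by apply: Cvec Cc _ => i; rewrite inE.
have [A CA Amin] := arg_minnP (P := fun A => C (vec A)) (fun A : {set 'I_n} => #|A|) CA0.
have [v [vA _]] := hC _ _ CA CA.
have {}vA : v \in A by move: vA; rewrite vecE; case: (v \in A).
have Cv : C (vec [set v]).
  (* Modulo [alpha i + 1] the entries are 0 at v, -1 on the rest of A and -2 off A, so they vanish
     after a shift by 0, 1 and 2 respectively. As [alpha i >= 2], the entries -1 and -2 are nonzero
     before shifting. *)
  pose x : expvec := [ffun i => inord (if i == v then 0 else
    if i \in A then alpha i else (alpha i).-1)].
  have xE i : x i = (if i == v then 0 else
    if i \in A then alpha i else (alpha i).-1) :> nat.
    by rewrite ffunE inordK //; case: ifP => //; case: ifP; lia.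
  have [c Cc] := orb x.
  have c_lt := ltn_ord c.
  have sE i : (shift c x i == 0 :> nat) = if i == v then c == 0 :> nat else
      if i \in A then c == 1 :> nat else c == 2 :> nat.
    have mi := hm i.
    rewrite shiftE ?xE; last lia.
    case: (i =P v) => _; first by case: ifP; lia.
    by case: (i \in A); case: ifP; lia.
  have [c0|c_neq0] := eqVneq (c : nat) 0.
    apply: Cvec Cc _ => i /eqP; rewrite sE inE c0.
    by case: ifP => //; case: ifP.
  have [c1|c_neq1] := eqVneq (c : nat) 1.
    have CAv : C (vec (A :\ v)).
      apply: Cvec Cc _ => i /eqP; rewrite sE !inE c1.
      by case: ifP => //; case: ifP.
    by have := Amin _ CAv; rewrite (cardsD1 v A) vA add1n ltnn.
  (* For [c >= 2] the shifted vector has no zero in A, so it shares none with [vec A]. *)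
  have [i [/eqP]] := hC _ _ Cc CA; rewrite sE vecE (negPf c_neq0) (negPf c_neq1).
  by case: ifP => // _; case: ifP.
exists v; split; last first.
  by move=> y yv; apply: Cup Cv _ => i; rewrite vecE inE; case: eqP => // ->.
(* A shift of the all-ones vector in C must vanish at v, the only zero of [vec [set v]]; this forces
   [c = alpha v], while [c < m]. *)
have [c Cc] := orb (vec set0); have c_lt := ltn_ord c; have mv := hm v.
have [i [s0]] := hC _ _ Cc Cv; rewrite vecE inE; case: eqP => // iv _.
by move: s0; rewrite iv shiftE ?vecE ?inE /=; [case: ifP; lia|lia].
Qed.

End ExponentVectors.

(** * Divisors of N as exponent vectors *)

Section PrimePowerProducts.

Variables (n : nat) (p : 'I_n -> nat).
Hypotheses (p_prime : forall i, prime (p i)) (p_inj : injective p).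

Definition pprod (e : 'I_n -> nat) : nat := \prod_(i < n) p i ^ e i.

Lemma pprod_gt0 (e : 'I_n -> nat) : 0 < pprod e.
Proof. by apply: prodn_gt0 => i; rewrite expn_gt0 prime_gt0. Qed.

Lemma logn_pprod_sum (e : 'I_n -> nat) (q : nat) :
  logn q (pprod e) = \sum_(i < n) e i * (q == p i).
Proof.
rewrite /pprod; elim: (index_enum _) => [|i r IH]; first by rewrite !big_nil logn1.
rewrite !big_cons lognM; last 2 first.
- by rewrite expn_gt0 prime_gt0.
- by apply: prodn_gt0 => j; rewrite expn_gt0 prime_gt0.
by rewrite IH lognX logn_prime.
Qed.

Lemma logn_pprod (e : 'I_n -> nat) (i : 'I_n) : logn (p i) (pprod e) = e i.
Proof.
rewrite logn_pprod_sum (bigD1 i) //= eqxx muln1 big1 ?addn0 // => j ji.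
by rewrite (inj_eq p_inj) eq_sym (negPf ji) muln0.
Qed.

Lemma logn_pprod0 (e : 'I_n -> nat) (q : nat) :
  (forall i, q != p i) -> logn q (pprod e) = 0.
Proof.
by move=> hq; rewrite logn_pprod_sum big1 // => i _; rewrite (negPf (hq i)) muln0.
Qed.

Lemma dvdn_pprod (e : 'I_n -> nat) (i : 'I_n) : (p i %| pprod e) = (0 < e i).
Proof. by rewrite -[p i]expn1 pfactor_dvdn ?logn_pprod // pprod_gt0. Qed.

Lemma coprime_pprodPn (e f : 'I_n -> nat) :
  reflect (exists i, 0 < e i /\ 0 < f i) (~~ coprime (pprod e) (pprod f)).
Proof.
rewrite coprime_has_primes ?pprod_gt0 // negbK.
apply: (iffP hasP) => [[q]|[i [ei fi]]].
  rewrite /= -!logn_gt0 => hf he.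
  have [/existsP[i /eqP qi]|] := boolP [exists i, q == p i].
    by exists i; rewrite qi !logn_pprod in he hf.
  by rewrite negb_exists => /forallP hq; rewrite logn_pprod0 in hf.
by exists (p i); rewrite ?inE -logn_gt0 logn_pprod.
Qed.

Variable alpha : 'I_n -> nat.

Lemma pprod_in_divisors (x : expvec _ alpha) : pprod (fun i => x i) \in divisors (pprod alpha).
Proof.
rewrite -dvdn_divisors ?pprod_gt0 //.
rewrite /pprod; elim/big_ind2: _ => // [a b c d|i _]; first exact: dvdn_mul.
by rewrite dvdn_exp2l // -ltnS.
Qed.

Lemma divisors_pprodP (d : nat) :
  d \in divisors (pprod alpha) -> exists x : expvec _ alpha, d = pprod (fun i => x i).
Proof.
rewrite -dvdn_divisors ?pprod_gt0 // => dN.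
pose x : expvec _ alpha := [ffun i => inord (logn (p i) d)].
have d_le q : logn q d <= logn q (pprod alpha) by rewrite dvdn_leq_log ?pprod_gt0.
have d_gt0 : 0 < d by apply: dvdn_gt0 dN; exact: pprod_gt0.
exists x; apply: eqn_from_log; rewrite ?pprod_gt0 // => q.
have [/existsP[i /eqP ->]|] := boolP [exists i, q == p i].
  rewrite logn_pprod ffunE inordK // ltnS.
  by rewrite -[alpha i]logn_pprod.
rewrite negb_exists => /forallP hq; rewrite logn_pprod0 //.
by have := d_le q; rewrite logn_pprod0 //; case: logn.
Qed.

Lemma pprod_inj : injective (fun x : expvec _ alpha => pprod (fun i => x i)).
Proof.
move=> x y exy; apply/ffunP => i; apply/val_inj => /=.
by rewrite -(logn_pprod (fun i => x i)) exy logn_pprod.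
Qed.

Lemma card_divisors_fsetC (D : {fset nat}) : {subset D <= divisors (pprod alpha)} ->
  #|` D| + #|[pred x : expvec _ alpha | pprod (fun i => x i) \notin D]| = #|expvec _ alpha|.
Proof.
move=> sD; rewrite -(cardC [pred x : expvec _ alpha | pprod (fun i => x i) \in D]).
congr (_ + _)%N; set P := [pred x | _].
have -> : D = [fset pprod (fun i => x i) | x : expvec _ alpha in P]%fset.
  apply/fsetP => d; apply/idP/imfsetP => /= [dD|[x xD ->//]].
  by have [x dx] := divisors_pprodP _ (sD d dD); exists x; rewrite // inE -dx.
by rewrite card_imfset /= -?cardE //; exact: pprod_inj.
Qed.

End PrimePowerProducts.

(** * Maximal N-sets and the multiples of a prime *)

Local Open Scope fset_scope.

(** Otherwise d could be added to D. The exception is [d = 1], coprime to itself: then D would be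
    empty and N could be added instead. *)
Lemma maximal_Nset_coprime (N : nat) (D : {fset nat}) (d : nat) :
  1 < N -> maximal_Nset N D -> d \in divisors N -> d \notin D ->
  exists2 e, e \in D & coprime d e.
Proof.
move=> N_gt1 [[sD cD] maxD] dN dD.
have ND : N \in divisors N by rewrite divisors_id // ltnW.
have nset_add (c : nat) : c \in divisors N -> c != 1 ->
    (forall e, e \in D -> ~~ coprime c e) -> Nset N (c |` D).
  move=> cN c1 hc; split=> [e|e f]; first by rewrite in_fset1U => /orP[/eqP->|/sD].
  rewrite !in_fset1U => /orP[/eqP->|eD] /orP[/eqP->|fD]; last exact: cD.
  - by rewrite /coprime gcdnn.
  - exact: hc.
  - by rewrite coprime_sym hc.
have [/hasP[e eD de]|/hasPn ncop] := boolP (has (coprime d) D); first by exists e.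
have [d1|d1] := eqVneq d 1; last by case: (maxD d dN dD); exact: nset_add.
have D0 e : e \notin D by apply/negP => /ncop; rewrite d1 coprime1n.
case: (maxD N ND (D0 N)); apply: nset_add => // [|e]; first by rewrite gtn_eqF.
by rewrite (negPf (D0 e)).
Qed.

Lemma in_R1 (N q d : nat) : (d \in R [fset q] N) = (d \in divisors N) && (q %| d).
Proof.
rewrite in_R; congr (_ && _); apply/hasP/idP => [[t]|qd]; first by rewrite inE => /eqP->.
by exists q; rewrite ?inE.
Qed.

(** A divisor outside the set is coprime to q, which is itself a member. *)
Lemma maximal_Nset_R_prime (N q : nat) :
  0 < N -> prime q -> q %| N -> maximal_Nset N (R [fset q] N).
Proof.
move=> N_gt0 q_prime qN.
split; first split=> [d|d e].
- by rewrite in_R1 => /andP[].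
- rewrite !in_R1 => /andP[_ qd] /andP[_ qe]; apply/negP => /eqP de.
  by have := dvdn_gcd q d e; rewrite de qd qe dvdn1 gtn_eqF ?prime_gt1.
- move=> d dN; rewrite in_R1 dN /= => qd [_ cop].
  have: ~~ coprime q d.
    by apply: cop; rewrite in_fset1U ?eqxx // in_R1 -dvdn_divisors // qN dvdnn orbT.
  by rewrite prime_coprime // qd.
Qed.

Lemma maximal_Nset_sub_R (N q : nat) (D : {fset nat}) :
  0 < N -> prime q -> q %| N -> maximal_Nset N D -> D `<=` R [fset q] N ->
  D = R [fset q] N.
Proof.
move=> N_gt0 q_prime qN [_ maxD] /fsubsetP sD; apply/fsetP => d.
apply/idP/idP => [/sD//|dR]; apply: contraT => dD.
have [[sR cR] _] := maximal_Nset_R_prime _ _ N_gt0 q_prime qN.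
case: (maxD d (sR d dR) dD).
have sdD : {subset d |` D <= R [fset q] N}.
  by move=> e; rewrite in_fset1U => /orP[/eqP->|/sD].
by split=> [e /sdD/sR|e f /sdD eR /sdD fR]; last exact: cR.
Qed.

Theorem theorem4 (n u : nat) (p alpha : 'I_n -> nat) (N : nat)
  (p_prime : forall i : 'I_n, prime (p i))
  (p_inj : injective p)
  (N_def : N = \prod_(i < n) p i ^ alpha i)
  (u_lt_n : u < n)
  (alpha_noninc : forall i j : 'I_n, i <= j -> alpha j <= alpha i)
  (alpha_drop : forall i j : 'I_n, i < u -> u <= j -> alpha j < alpha i)
  (alpha_const : forall i j : 'I_n, u <= i -> u <= j -> alpha i = alpha j)
  (alpha_ge2 : forall i : 'I_n, u <= i -> 2 <= alpha i)
  (D : {fset nat}) :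
  min_maximal_Nset N D <->
  exists v : 'I_n, u <= v /\ D = R [fset p v] N.
Proof.
(* Indices start at 0, so w is the first index of the constant tail and a is the least exponent. *)
pose w := Ordinal u_lt_n; pose a := alpha w.
have a_ge2 : 2 <= a by exact: alpha_ge2.
have a_min i : a <= alpha i.
  have [iu|ui] := ltnP i u; first by apply/ltnW/alpha_drop.
  by rewrite /a (alpha_const w i).
have alphaE (i : 'I_n) : u <= i -> alpha i = a by move=> ui; exact: alpha_const.
have {}N_def : N = pprod n p alpha by [].
have N_gt0 : 0 < N by rewrite N_def pprod_gt0.
have pN i : p i %| N.
  by rewrite N_def dvdn_pprod //; apply: leq_trans (a_min i); exact: ltnW.
have N_gt1 : 1 < N by apply: leq_trans (dvdn_leq N_gt0 (pN w)); exact: prime_gt1.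
pose val (x : expvec n alpha) := pprod n p (fun i => x i).
pose out (E : {fset nat}) := [pred x | val x \notin E].
have val_dvd x : val x \in divisors N by rewrite N_def pprod_in_divisors.
have card_out E : maximal_Nset N E -> (#|` E| + #|out E| = #|expvec n alpha|)%N.
  by move=> [[sE _] _]; apply: card_divisors_fsetC => //; rewrite -N_def.
have valP d : d \in divisors N -> exists x, d = val x.
  by rewrite N_def => /divisors_pprodP; exact.
have val_coprimePn x y := coprime_pprodPn n p p_prime p_inj (fun i => x i) (fun i => y i).
have outE E (x : expvec n alpha) : maximal_Nset N E -> val x \notin E ->
    exists2 e : expvec n alpha, val e \in E & forall i, 0 < e i -> x i = 0 :> nat.
  move=> maxE xE.
  have [e eE xe] := maximal_Nset_coprime N E _ N_gt1 maxE (val_dvd x) xE.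
  have [[sE _] _] := maxE; have [f ef] := valP _ (sE _ eE).
  exists f => [|i fi]; first by rewrite -ef.
  apply/eqP; rewrite eqn0Ngt; apply/negP => xi.
  by move: xe; apply/negP; rewrite ef; apply/val_coprimePn; exists i.
(* The members e and f coprime to x and y share a prime, and both x and y vanish at its index. *)
have outP E : maximal_Nset N E -> share_zeros _ _ (out E).
  move=> maxE x y /outE-/(_ maxE)[e eE xe] /outE-/(_ maxE)[f fE yf].
  have [[_ cE] _] := maxE.
  by have /val_coprimePn[i [/xe ? /yf ?]] := cE _ _ eE fE; exists i.
(* A member of E coprime to x is also coprime to y, which has at least the zeros of x. *)
have out_up E (x y : expvec n alpha) : maximal_Nset N E -> out E x ->
    (forall i, x i = 0 :> nat -> y i = 0 :> nat) -> out E y.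
  move=> maxE /outE-/(_ maxE)[e eE xe] xy.
  have [[_ cE] _] := maxE; apply/negP => yE.
  by have /val_coprimePn[i [yi /xe/xy yi0]] := cE _ _ yE eE; rewrite yi0 in yi.
have bound E : maximal_Nset N E -> a.+1 * #|out E| <= #|expvec n alpha| ?= iff
    [forall x, [exists c : 'I_a.+1, out E (shift _ _ c x)]].
  by move=> maxE; apply: leqif_card_share_zeros => //; exact: outP.
have maxR i := maximal_Nset_R_prime _ _ N_gt0 (p_prime i) (pN i).
have card_outR (i : 'I_n) : u <= i -> (a.+1 * #|out (R [fset p i] N)| = #|expvec n alpha|)%N.
  move=> ui; rewrite -(alphaE i ui) -(card_coord_zero _ alpha i); last first.
    by move=> j; rewrite alphaE.
  congr (_ * _)%N; apply: eq_card => x; rewrite [LHS]inE [RHS]inE /= in_R1 val_dvd /=.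
  by rewrite eqn0Ngt -(dvdn_pprod _ p p_prime p_inj (fun j => x j)).
split=> [[maxD minD]|[v [uv ->]]].
  (* D is no larger than [R [fset p w] N], whose complement attains the bound; so the complement of
     D attains it too. *)
  have full : #|expvec n alpha| <= a.+1 * #|out D|.
    rewrite -(card_outR w) // leq_pmul2l //.
    by have := minD _ (maxR w); have := card_out _ maxD; have := card_out _ (maxR w); lia.
  have /forallP orb : [forall x, [exists c : 'I_a.+1, out D (shift _ _ c x)]].
    by rewrite -(bound D maxD) eqn_leq full andbT; case: (bound D maxD).
  have [|||x y||v [va vD]] := share_zeros_star n alpha (out D) a.+1 => //.
  - exact: outP.
  - exact: out_up.
  - by move=> x; apply/existsP.
  (* An index below u would have exponent greater than a, against [alpha v < a.+1]. *)
  exists v; split; first by case: leqP => // /alpha_drop/(_ (leqnn w)); rewrite -/a; lia.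
  apply: maximal_Nset_sub_R => //; apply/fsubsetP => d dD.
  have dN : d \in divisors N by case: maxD => [[sD _] _]; exact: sD.
  have [x dx] := valP _ dN.
  (* If the exponent of d at v were 0, [vD] would put d outside D. *)
  rewrite in_R1 dN dx dvdn_pprod // lt0n; apply/eqP => /vD /=.
  by rewrite -dx dD.
(* Conversely, no complement of a maximal N-set exceeds that of [R [fset p v] N], which attains the
   bound. *)
split=> // E maxE.
have := card_out _ maxE; have := card_out _ (maxR v).
have : #|out E| <= #|out (R [fset p v] N)|.
  by rewrite -(leq_pmul2l (ltn0Sn a)) card_outR //; case: (bound E maxE).
lia.
Qed.
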